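(* Let $A$ and $B$ be isoclinic skew braces. Then there is a bijective correspondence between the set of sub skew braces of $A$ containing $\operatorname{Ann}(A)$ and the set of sub skew braces of $B$ containing $\operatorname{Ann}(B)$, such that corresponding sub skew braces are isoclinic.
   Context: A skew brace is a triple $(A,+,\circ)$ where $(A,+)$ and $(A,\circ)$ are groups (neither assumed commutative) with $a\circ(b+c)=a\circ b-a+a\circ c$ for all $a,b,c\in A$. The two groups share the identity $0$. A sub skew brace is a subset that is a subgroup of both groups. Put $\lambda_a(b)=-a+a\circ b$, $a*b=-a+a\circ b-b$, $[a,b]_+=a+b-a-b$. The annihilator is $\operatorname{Ann}(A)=\ker\lambda\cap Z(A,+)\cap Z(A,\circ)$, an ideal of $A$, so that $A/\operatorname{Ann}(A)$ is a skew brace; $\overline{a}$ denotes the class of $a$. The commutator $A'$ of $A$ is the additive subgroup generated by all $[a,b]_+$ and all $a*b$, $a,b\in A$; it is an ideal of $A$ (in particular a sub skew brace). The values $[a,b]_+$ and $a*b$ depend only on the classes of $a,b$ modulo $\operatorname{Ann}(A)$. Skew braces $A$ and $B$ are isoclinic if there is an isoclinism $(\xi,\theta)$, i.e. skew brace isomorphisms $\xi\colon A/\operatorname{Ann}(A)\to B/\operatorname{Ann}(B)$ and $\theta\colon A'\to B'$ such that, whenever $a_1,a_2\in A$ and $b_1,b_2\in B$ satisfy $\xi(\overline{a_i})=\overline{b_i}$ for $i=1,2$, one has $\theta([a_1,a_2]_+)=[b_1,b_2]_+$ and $\theta(a_1*a_2)=b_1*b_2$. *)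

(* Defs.v *)
From HB Require Import structures.
From mathcomp Require Import all_boot.
From mathcomp Require Import boolp classical_sets functions.

Set Implicit Arguments.
Unset Strict Implicit.
Unset Printing Implicit Defensive.

Local Open Scope classical_set_scope.
Local Open Scope quotient_scope.

(* (A, ∘) is the library's [groupType] structure on A, with unit 1%g and
   inverse a^-1%g.  (A, +) has its own operations, because the additive groups
   of the library ([zmodType]) are commutative.  The choice structure included
   in [groupType] is no restriction on A: classically every type has one, see
   {classic T} in boolp. *)
HB.mixin Record isSkewBrace A of Group A := {
  brace_add : A -> A -> A;
  brace_zero : A;
  brace_opp : A -> A;
  brace_addA : associative brace_add;
  brace_add0l : left_id brace_zero brace_add;
  brace_add0r : right_id brace_zero brace_add;
  brace_addNl : left_inverse brace_zero brace_opp brace_add;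
  brace_addNr : right_inverse brace_zero brace_opp brace_add;
  brace_compat : forall a b c : A,
    (a * brace_add b c)%g
    = brace_add (brace_add (a * b)%g (brace_opp a)) (a * c)%g
}.

#[short(type="skewBraceType")]
HB.structure Definition SkewBrace := {A of isSkewBrace A & Group A}.

Reserved Notation "a ∘ b" (at level 40, left associativity).
Declare Scope brace_scope.
Delimit Scope brace_scope with B.
Notation "a ∘ b" := (a * b)%g : brace_scope.
Notation "a + b" := (brace_add a b) : brace_scope.
Notation "- a" := (brace_opp a) : brace_scope.
Notation "a - b" := (brace_add a (brace_opp b)) : brace_scope.
Notation "0" := brace_zero : brace_scope.
Local Open Scope brace_scope.

(* An alias of A whose [groupType] structure is (A, +), through which the
   group lemmas of the library apply to the addition. *)
Definition add_group (A : skewBraceType) : Type := A.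
HB.instance Definition _ (A : skewBraceType) := Choice.on (add_group A).
HB.instance Definition _ (A : skewBraceType) :=
  isGroup.Build (add_group A) (@brace_addA A) (@brace_add0l A)
    (@brace_add0r A) (@brace_addNl A) (@brace_addNr A).

Section Theory.
Variable A : skewBraceType.
Implicit Types a b c x y : A.

Definition lam a b : A := - a + a ∘ b.
Definition star a b : A := - a + a ∘ b - b.
Definition add_comm a b : A := a + b - a - b.

Lemma brace_addKl a b : - a + (a + b) = b.
Proof. exact: (@mulKg (add_group A)). Qed.

Lemma brace_addNKl a b : a + (- a + b) = b.
Proof. exact: (@mulVKg (add_group A)). Qed.

Lemma brace_addKr a b : b + a - a = b.
Proof. exact: (@mulgK (add_group A)). Qed.

Lemma brace_addNKr a b : b - a + a = b.
Proof. exact: (@mulgVK (add_group A)). Qed.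

Lemma brace_addIl a b c : a + b = a + c -> b = c.
Proof. exact: (@mulgI (add_group A)). Qed.

Lemma brace_oppK a : - - a = a.
Proof. exact: (@invgK (add_group A)). Qed.

Lemma brace_oppD a b : - (a + b) = - b - a.
Proof. exact: (@invgM (add_group A)). Qed.

Lemma brace_opp0 : - 0 = 0 :> A.
Proof. exact: (@invg1 (add_group A)). Qed.

Lemma circ0 a : a ∘ 0 = a.
Proof.
have := brace_compat a 0 0; rewrite brace_add0l -brace_addA => /esym e.
have : a ∘ 0 + (- a + a ∘ 0) = a ∘ 0 + 0 by rewrite e brace_add0r.
by move/brace_addIl => e'; rewrite -[LHS](brace_addNKl a) e' brace_add0r.
Qed.

Lemma circ_one : (1%g : A) = 0.
Proof. by rewrite -[LHS]circ0 mul1g. Qed.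

Lemma circE a b : a ∘ b = a + lam a b.
Proof. by rewrite /lam brace_addNKl. Qed.

Lemma lamD a b c : lam a (b + c) = lam a b + lam a c.
Proof. by rewrite /lam brace_compat !brace_addA. Qed.

Lemma lam0 a : lam a 0 = 0.
Proof. by rewrite /lam circ0 brace_addNl. Qed.

Lemma lamN a b : lam a (- b) = - lam a b.
Proof.
apply: (@brace_addIl (lam a b)).
by rewrite -lamD !brace_addNr lam0.
Qed.

Lemma lamM a b c : lam (a ∘ b) c = lam a (lam b c).
Proof.
apply: (@brace_addIl (a ∘ b)); rewrite -circE -mulgA (circE b c).
by rewrite (circE a (b + _)) lamD brace_addA -circE.
Qed.

Lemma lam1 a : lam 0 a = a.
Proof. by rewrite /lam -circ_one mul1g circ_one brace_opp0 brace_add0l. Qed.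

Lemma lamVK a b : lam a^-1%g (lam a b) = b.
Proof. by rewrite -lamM mulVg circ_one lam1. Qed.

Lemma lamKV a b : lam a (lam a^-1%g b) = b.
Proof. by rewrite -lamM mulgV circ_one lam1. Qed.

Lemma starE a b : star a b + b = lam a b.
Proof. by rewrite /star brace_addNKr. Qed.

Lemma circVE a : a^-1%g = lam a^-1%g (- a).
Proof.
rewrite lamN /lam mulVg circ_one brace_add0r.
by rewrite brace_oppK.
Qed.

Definition is_add_subgroup (S : set A) :=
  [/\ S 0, (forall x y, S x -> S y -> S (x + y))
    & forall x, S x -> S (- x)].

Definition is_circ_subgroup (S : set A) :=
  [/\ S 1%g, (forall x y, S x -> S y -> S (x ∘ y))
    & forall x, S x -> S x^-1%g].

Definition is_sub_skew_brace (S : set A) :=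
  is_add_subgroup S /\ is_circ_subgroup S.

Definition is_ideal (I : set A) :=
  [/\ is_sub_skew_brace I,
      (forall a x, I x -> I (a + x - a)),
      (forall a x, I x -> I (a ∘ x ∘ a^-1%g))
    & forall a x, I x -> I (lam a x)].

Definition ker_lam : set A := [set a | forall x, lam a x = x].
Definition add_center : set A := [set a | forall x, a + x = x + a].
Definition circ_center : set A := [set a | forall x, a ∘ x = x ∘ a].
Definition ann_set : set A := ker_lam `&` add_center `&` circ_center.

Definition commutator_set : set A :=
  smallest is_add_subgroup
    ([set add_comm a b | a in setT & b in setT]
     `|` [set star a b | a in setT & b in setT]).

Lemma ann_setP : is_ideal ann_set.
Proof.
have annD a x : ann_set a -> a ∘ x = a + x.
  by case=> -[ka _] _; rewrite circE ka.
have cl0 : ann_set 0.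
  split; [split|] => x /=; first exact: lam1.
    by rewrite brace_add0l brace_add0r.
  by rewrite -circ_one mulg1 mul1g.
have clM x y : ann_set x -> ann_set y -> ann_set (x ∘ y).
  move=> Ax Ay; have xyE := annD x y Ax.
  case: Ax => -[kx zx] cx; case: Ay => -[ky zy] cy.
  split; [split|] => z /=; first by rewrite lamM ky kx.
    by rewrite xyE -brace_addA (zy z) brace_addA (zx z) -brace_addA.
  by rewrite -mulgA (cy z) mulgA (cx z) -mulgA.
have clN x : ann_set x -> ann_set x^-1%g /\ x^-1%g = - x.
  move=> Ax; have xVE : x^-1%g = - x.
    by apply: (@brace_addIl x); rewrite -annD // mulgV circ_one brace_addNr.
  split=> //; case: Ax => -[kx zx] cx.
  split; [split|] => z /=; first by rewrite -{1}(kx z) lamVK.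
    by rewrite xVE; apply: (@brace_addIl x);
       rewrite brace_addNKl brace_addA zx -brace_addA brace_addNr brace_add0r.
  by apply: (@mulgI _ x); rewrite mulVKg mulgA cx -mulgA mulgV mulg1.
have clD x y : ann_set x -> ann_set y -> ann_set (x + y).
  by move=> Ax Ay; rewrite -annD //; apply: clM.
split.
- split; split=> //; last 1 first.
  + by move=> x /clN[].
  + by move=> x /clN[+ <-].
  + by rewrite circ_one.
- move=> a x Ax; case: (Ax) => -[_ zx] _.
  by rewrite -zx brace_addKr.
- move=> a x Ax; case: (Ax) => _ cx.
  by rewrite -cx mulgK.
- move=> a x Ax; case: (Ax) => _ cx.
  rewrite /lam -cx annD //; case: (Ax) => -[_ zx] _.
  by rewrite zx brace_addKl.
Qed.

Lemma add_comm_in a b : commutator_set (add_comm a b).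
Proof. by apply: sub_gen_smallest; left; exists a => //; exists b. Qed.

Lemma star_in a b : commutator_set (star a b).
Proof. by apply: sub_gen_smallest; right; exists a => //; exists b. Qed.

Lemma commutator_setP : is_sub_skew_brace commutator_set.
Proof.
have sg : is_add_subgroup commutator_set.
  split=> [M [[]]//|x y Mx My M MP|x Mx M MP].
  - by case: (MP) => -[_ MD _] _; apply: MD; [apply: Mx|apply: My].
  - by case: (MP) => -[_ _ MN] _; apply: MN; apply: Mx.
case: (sg) => M0 MD MN.
have Ml a x : commutator_set x -> commutator_set (lam a x).
  by move=> Mx; rewrite -starE; apply: MD => //; apply: star_in.
split=> //; split; first by rewrite circ_one.
  by move=> x y Mx My; rewrite circE; apply: MD => //; apply: Ml.
by move=> x Mx; rewrite circVE; apply: (Ml); apply: (MN).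
Qed.

End Theory.

Record subSkewBrace (A : skewBraceType) := SubSkewBrace {
  sub_set :> set A;
  sub_setP : is_sub_skew_brace sub_set
}.

Lemma subSkewBrace_ext (A : skewBraceType) (S T : subSkewBrace A) :
  sub_set S = sub_set T -> S = T.
Proof.
case: S T => [S PS] [T PT] /= eST; case: T / eST PT => PT.
by rewrite (Prop_irrelevance PS PT).
Qed.

Record ideal (A : skewBraceType) := Ideal {
  ideal_set :> set A;
  ideal_setP : is_ideal ideal_set
}.

Definition Ann (A : skewBraceType) : ideal A := Ideal (@ann_setP A).

Definition commutator (A : skewBraceType) : subSkewBrace A :=
  SubSkewBrace (@commutator_setP A).

Section SubBrace.
Variables (A : skewBraceType) (S : subSkewBrace A).

Definition sub_brace : Type := set_type S.
HB.instance Definition _ := SubChoice.on sub_brace.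

Lemma sub_add_subproof (x y : sub_brace) : val x + val y \in sub_set S.
Proof.
by case: (sub_setP S) => -[_ SD _] _; apply/mem_set/SD; apply/set_mem/valP.
Qed.

Lemma sub_zero_subproof : (0 : A) \in sub_set S.
Proof. by case: (sub_setP S) => -[S0 _ _] _; apply/mem_set. Qed.

Lemma sub_opp_subproof (x : sub_brace) : - val x \in sub_set S.
Proof.
by case: (sub_setP S) => -[_ _ SN] _; apply/mem_set/SN; apply/set_mem/valP.
Qed.

Lemma sub_mul_subproof (x y : sub_brace) : val x ∘ val y \in sub_set S.
Proof.
by case: (sub_setP S) => _ [_ SM _]; apply/mem_set/SM; apply/set_mem/valP.
Qed.

Lemma sub_one_subproof : (1%g : A) \in sub_set S.
Proof. by case: (sub_setP S) => _ [S1 _ _]; apply/mem_set. Qed.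

Lemma sub_inv_subproof (x : sub_brace) : (val x)^-1%g \in sub_set S.
Proof.
by case: (sub_setP S) => _ [_ _ SV]; apply/mem_set/SV; apply/set_mem/valP.
Qed.

Definition sub_add (x y : sub_brace) : sub_brace :=
  exist (fun z => z \in sub_set S) _ (sub_add_subproof x y).
Definition sub_zero : sub_brace :=
  exist (fun z => z \in sub_set S) _ sub_zero_subproof.
Definition sub_opp (x : sub_brace) : sub_brace :=
  exist (fun z => z \in sub_set S) _ (sub_opp_subproof x).
Definition sub_mul (x y : sub_brace) : sub_brace :=
  exist (fun z => z \in sub_set S) _ (sub_mul_subproof x y).
Definition sub_one : sub_brace :=
  exist (fun z => z \in sub_set S) _ sub_one_subproof.
Definition sub_inv (x : sub_brace) : sub_brace :=
  exist (fun z => z \in sub_set S) _ (sub_inv_subproof x).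

Lemma sub_mulA : associative sub_mul.
Proof. by move=> x y z; apply: val_inj; apply: mulgA. Qed.
Lemma sub_mul1l : left_id sub_one sub_mul.
Proof. by move=> x; apply: val_inj; apply: mul1g. Qed.
Lemma sub_mul1r : right_id sub_one sub_mul.
Proof. by move=> x; apply: val_inj; apply: mulg1. Qed.
Lemma sub_mulVl : left_inverse sub_one sub_inv sub_mul.
Proof. by move=> x; apply: val_inj; apply: mulVg. Qed.
Lemma sub_mulVr : right_inverse sub_one sub_inv sub_mul.
Proof. by move=> x; apply: val_inj; apply: mulgV. Qed.

HB.instance Definition _ :=
  isGroup.Build sub_brace sub_mulA sub_mul1l sub_mul1r sub_mulVl sub_mulVr.

Lemma sub_addA : associative sub_add.
Proof. by move=> x y z; apply: val_inj; apply: brace_addA. Qed.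
Lemma sub_add0l : left_id sub_zero sub_add.
Proof. by move=> x; apply: val_inj; apply: brace_add0l. Qed.
Lemma sub_add0r : right_id sub_zero sub_add.
Proof. by move=> x; apply: val_inj; apply: brace_add0r. Qed.
Lemma sub_addNl : left_inverse sub_zero sub_opp sub_add.
Proof. by move=> x; apply: val_inj; apply: brace_addNl. Qed.
Lemma sub_addNr : right_inverse sub_zero sub_opp sub_add.
Proof. by move=> x; apply: val_inj; apply: brace_addNr. Qed.
Lemma sub_compat (a b c : sub_brace) :
  sub_mul a (sub_add b c)
  = sub_add (sub_add (sub_mul a b) (sub_opp a)) (sub_mul a c).
Proof. by apply: val_inj; apply: brace_compat. Qed.

HB.instance Definition _ := isSkewBrace.Build sub_brace
  sub_addA sub_add0l sub_add0r sub_addNl sub_addNr sub_compat.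

End SubBrace.

Section Quotient.
Variables (A : skewBraceType) (I : ideal A).
Implicit Types a b x y : A.

Definition ideal_eqv : rel A := fun a b => `[< ideal_set I (- a + b) >].

Lemma ideal_eqvP a b :
  reflect (exists2 i, ideal_set I i & b = a + i) (ideal_eqv a b).
Proof.
apply: (iffP (asboolP _)) => [Iab|[i Ii ->]]; last by rewrite brace_addKl.
by exists (- a + b) => //; rewrite brace_addNKl.
Qed.

Lemma ideal_eqv_circP a b :
  reflect (exists2 i, ideal_set I i & b = a ∘ i) (ideal_eqv a b).
Proof.
case: (ideal_setP I) => _ _ _ Il.
apply: (iffP (ideal_eqvP a b)) => -[i Ii ->].
  by exists (lam a^-1%g i); [apply: Il|rewrite circE lamKV].
by exists (lam a i); [apply: Il|rewrite circE].
Qed.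

Lemma ideal_eqv_equiv : equiv_class_of ideal_eqv.
Proof.
case: (ideal_setP I) => -[[I0 ID IN] _] _ _ _.
have sym a b : ideal_eqv a b -> ideal_eqv b a.
  move=> /ideal_eqvP[i Ii ->]; apply/ideal_eqvP; exists (- i); first exact: IN.
  by rewrite brace_addKr.
split=> [a|a b|b a c].
- by apply/asboolP; rewrite brace_addNl.
- by apply/idP/idP; apply: sym.
- move=> /ideal_eqvP[i Ii ->] /ideal_eqvP[j Ij ->]; apply/ideal_eqvP.
  by exists (i + j); [apply: ID|rewrite brace_addA].
Qed.

Canonical ideal_eqv_rel := EquivRelPack ideal_eqv_equiv.

Definition quot_brace : Type := {eq_quot ideal_eqv}.
HB.instance Definition _ := Choice.on quot_brace.
HB.instance Definition _ := EqQuotient.on quot_brace.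

Definition quot_add (x y : quot_brace) : quot_brace :=
  \pi_quot_brace (repr x + repr y).
Definition quot_zero : quot_brace :=
  \pi_quot_brace 0.
Definition quot_opp (x : quot_brace) : quot_brace :=
  \pi_quot_brace (- repr x).
Definition quot_mul (x y : quot_brace) : quot_brace :=
  \pi_quot_brace (repr x ∘ repr y).
Definition quot_one : quot_brace :=
  \pi_quot_brace 1%g.
Definition quot_inv (x : quot_brace) : quot_brace :=
  \pi_quot_brace (repr x)^-1%g.

Lemma quot_braceW (P : quot_brace -> Prop) :
  (forall a, P (\pi_quot_brace a)) -> forall q, P q.
Proof. by move=> Pa x; rewrite -[x]reprK; apply: Pa. Qed.

Lemma quot_eqP a b : reflect (\pi_quot_brace a = \pi_quot_brace b)
  (ideal_eqv a b).
Proof. exact: (@eqmodP _ ideal_eqv_rel). Qed.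

Lemma quot_reprP a : exists2 i, ideal_set I i & repr (\pi_quot_brace a) = a + i.
Proof. by apply/ideal_eqvP/quot_eqP; rewrite reprK. Qed.

Lemma quot_repr_circP a :
  exists2 i, ideal_set I i & repr (\pi_quot_brace a) = a ∘ i.
Proof. by apply/ideal_eqv_circP/quot_eqP; rewrite reprK. Qed.

Lemma quot_addE a b : quot_add (\pi_quot_brace a) (\pi_quot_brace b)
  = \pi_quot_brace (a + b).
Proof.
case: (ideal_setP I) => -[[_ ID _] _] Ic _ _.
apply/esym/quot_eqP/ideal_eqvP.
case: (quot_reprP a) (quot_reprP b) => i Ii -> [j Ij ->].
exists (- b + i - - b + j); first by apply: ID => //; apply: Ic.
by rewrite brace_oppK !brace_addA brace_addKr.
Qed.

Lemma quot_oppE a : quot_opp (\pi_quot_brace a) = \pi_quot_brace (- a).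
Proof.
case: (ideal_setP I) => -[[_ _ IN] _] Ic _ _.
apply/esym/quot_eqP/ideal_eqvP.
case: (quot_reprP a) => i Ii ->.
exists (a - i - a); first by apply/Ic/IN.
by rewrite brace_oppD !brace_addA brace_addNl brace_add0l.
Qed.

Lemma quot_mulE a b : quot_mul (\pi_quot_brace a) (\pi_quot_brace b)
  = \pi_quot_brace (a ∘ b).
Proof.
case: (ideal_setP I) => -[_ [_ IM _]] _ Ic _.
apply/esym/quot_eqP/ideal_eqv_circP.
case: (quot_repr_circP a) (quot_repr_circP b) => i Ii -> [j Ij ->].
exists (b^-1%g ∘ i ∘ b^-1%g^-1%g ∘ j); first by apply: IM => //; apply: Ic.
by rewrite invgK !mulgA mulgK.
Qed.

Lemma quot_invE a : quot_inv (\pi_quot_brace a) = \pi_quot_brace a^-1%g.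
Proof.
case: (ideal_setP I) => -[_ [_ _ IV]] _ Ic _.
apply/esym/quot_eqP/ideal_eqv_circP.
case: (quot_repr_circP a) => i Ii ->.
exists (a ∘ i^-1%g ∘ a^-1%g); first by apply/Ic/IV.
by rewrite invgM !mulgA mulVg mul1g.
Qed.

Lemma quot_mulA : associative quot_mul.
Proof.
elim/quot_braceW=> x; elim/quot_braceW=> y; elim/quot_braceW=> z.
by rewrite !quot_mulE mulgA.
Qed.
Lemma quot_mul1l : left_id quot_one quot_mul.
Proof. by elim/quot_braceW=> x; rewrite quot_mulE mul1g. Qed.
Lemma quot_mul1r : right_id quot_one quot_mul.
Proof. by elim/quot_braceW=> x; rewrite quot_mulE mulg1. Qed.
Lemma quot_mulVl : left_inverse quot_one quot_inv quot_mul.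
Proof. by elim/quot_braceW=> x; rewrite quot_invE quot_mulE mulVg. Qed.
Lemma quot_mulVr : right_inverse quot_one quot_inv quot_mul.
Proof. by elim/quot_braceW=> x; rewrite quot_invE quot_mulE mulgV. Qed.

HB.instance Definition _ := isGroup.Build quot_brace
  quot_mulA quot_mul1l quot_mul1r quot_mulVl quot_mulVr.

Lemma quot_addA : associative quot_add.
Proof.
elim/quot_braceW=> x; elim/quot_braceW=> y; elim/quot_braceW=> z.
by rewrite !quot_addE brace_addA.
Qed.
Lemma quot_add0l : left_id quot_zero quot_add.
Proof. by elim/quot_braceW=> x; rewrite quot_addE brace_add0l. Qed.
Lemma quot_add0r : right_id quot_zero quot_add.
Proof. by elim/quot_braceW=> x; rewrite quot_addE brace_add0r. Qed.
Lemma quot_addNl : left_inverse quot_zero quot_opp quot_add.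
Proof. by elim/quot_braceW=> x; rewrite quot_oppE quot_addE brace_addNl. Qed.
Lemma quot_addNr : right_inverse quot_zero quot_opp quot_add.
Proof. by elim/quot_braceW=> x; rewrite quot_oppE quot_addE brace_addNr. Qed.
Lemma quot_compat (a b c : quot_brace) :
  quot_mul a (quot_add b c)
  = quot_add (quot_add (quot_mul a b) (quot_opp a)) (quot_mul a c).
Proof.
elim/quot_braceW: a => a; elim/quot_braceW: b => b; elim/quot_braceW: c => c.
by rewrite !(quot_addE, quot_mulE, quot_oppE) brace_compat.
Qed.

HB.instance Definition _ := isSkewBrace.Build quot_brace
  quot_addA quot_add0l quot_add0r quot_addNl quot_addNr quot_compat.

Lemma pi_add a b : \pi_quot_brace (a + b) = \pi_quot_brace a + \pi_quot_brace b.
Proof. by rewrite -quot_addE. Qed.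
Lemma pi_opp a : \pi_quot_brace (- a) = - \pi_quot_brace a.
Proof. by rewrite -quot_oppE. Qed.
Lemma pi_mul a b : \pi_quot_brace (a ∘ b) = \pi_quot_brace a ∘ \pi_quot_brace b.
Proof. by rewrite -quot_mulE. Qed.

End Quotient.

Definition ann_class (A : skewBraceType) (a : A) : quot_brace (Ann A) :=
  \pi_(quot_brace (Ann A)) a.

Definition commutator_add_comm (A : skewBraceType) (a b : A) :
  sub_brace (commutator A) :=
  exist (fun z => z \in sub_set (commutator A)) (add_comm a b)
    (mem_set (add_comm_in a b)).

Definition commutator_star (A : skewBraceType) (a b : A) :
  sub_brace (commutator A) :=
  exist (fun z => z \in sub_set (commutator A)) (star a b)
    (mem_set (star_in a b)).

Definition skew_brace_iso (A B : skewBraceType) (f : A -> B) :=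
  [/\ {morph f : x y / x + y}, {morph f : x y / x ∘ y} & bijective f].

Definition is_isoclinism (A B : skewBraceType)
    (xi : quot_brace (Ann A) -> quot_brace (Ann B))
    (theta : sub_brace (commutator A) -> sub_brace (commutator B)) :=
  [/\ skew_brace_iso xi, skew_brace_iso theta
    & forall (a1 a2 : A) (b1 b2 : B),
        xi (ann_class a1) = ann_class b1 ->
        xi (ann_class a2) = ann_class b2 ->
        theta (commutator_add_comm a1 a2) = commutator_add_comm b1 b2 /\
        theta (commutator_star a1 a2) = commutator_star b1 b2].

Definition isoclinic (A B : skewBraceType) :=
  exists xi theta, @is_isoclinism A B xi theta.

(* Main.v *)
Require Import Defs.
From mathcomp Require Import all_boot.
From mathcomp Require Import boolp classical_sets functions.

(** An isoclinism is encoded by a pair of relations between A and B: [R a b]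
    says that the classes of a and b modulo the annihilators correspond under
    xi, and [Th x y] that y is the image of x under theta.  Both are sub skew
    braces of A x B; [R] projects onto both factors, [Th] meets both factors
    trivially, and commutators of [R]-related pairs are [Th]-related.
    Conversely such a pair of relations yields an isoclinism, because elements
    of the annihilator are recognised by the vanishing of [a,b]_+, a * b and
    b * a for all b.  In this form isoclinisms restrict to sub skew braces S
    and T that correspond under [R], even though Ann(S) may be larger than
    Ann(A), and the correspondence sends S to its direct image under [R]. *)

Set Implicit Arguments.
Unset Strict Implicit.
Unset Printing Implicit Defensive.

Local Open Scope classical_set_scope.
Local Open Scope quotient_scope.
Local Open Scope brace_scope.

(** * Relations between skew braces *)

Definition brace_rel (A B : skewBraceType) (R : A -> B -> Prop) :=
  [/\ R 0 0,
      forall a b a' b', R a b -> R a' b' -> R (a + a') (b + b'),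
      forall a b, R a b -> R (- a) (- b),
      forall a b a' b', R a b -> R a' b' -> R (a ∘ a') (b ∘ b')
    & forall a b, R a b -> R a^-1%g b^-1%g].

Definition converse (A B : Type) (R : A -> B -> Prop) : B -> A -> Prop :=
  fun b a => R a b.

Definition total_rel (A B : Type) (R : A -> B -> Prop) :=
  forall a, exists b, R a b.

(** For a [brace_rel], which is closed under differences, this is injectivity; for its converse it
    is single-valuedness. *)
Definition trivial_kernel (A B : skewBraceType) (R : A -> B -> Prop) :=
  forall a, R a 0 -> a = 0.

Definition isoclinism_rel (A B : skewBraceType) (R Th : A -> B -> Prop) :=
  [/\ [/\ brace_rel R, total_rel R & total_rel (converse R)],
      [/\ brace_rel Th, trivial_kernel Th & trivial_kernel (converse Th)]
    & forall a1 b1 a2 b2, R a1 b1 -> R a2 b2 ->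
        Th (add_comm a1 a2) (add_comm b1 b2) /\ Th (star a1 a2) (star b1 b2)].

Lemma brace_rel_converse (A B : skewBraceType) (R : A -> B -> Prop) :
  brace_rel R -> brace_rel (converse R).
Proof.
case=> R0 RD RN RM RV; split=> //.
- by move=> a b a' b'; apply: RD.
- by move=> a b; apply: RN.
- by move=> a b a' b'; apply: RM.
- by move=> a b; apply: RV.
Qed.

(** This symmetry gives the second direction of every later argument for free. *)
Lemma isoclinism_rel_converse (A B : skewBraceType) (R Th : A -> B -> Prop) :
  isoclinism_rel R Th -> isoclinism_rel (converse R) (converse Th).
Proof.
case=> -[Rb Rl Rr] [Tb Tl Tr] RT; split.
- by split=> //; apply: brace_rel_converse.
- by split=> //; apply: brace_rel_converse.
- by move=> a1 b1 a2 b2; apply: RT.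
Qed.

(** * Recognising the annihilator by commutator values *)

Lemma brace_subr_eq0 (A : skewBraceType) (a b : A) : a - b = 0 <-> a = b.
Proof.
split=> [e|->]; last by rewrite brace_addNr.
by rewrite -[a](brace_addNKr b) e brace_add0l.
Qed.

Lemma brace_addNl_eq0 (A : skewBraceType) (a b : A) : - a + b = 0 -> a = b.
Proof. by move=> e; rewrite -[b](brace_addNKl a) e brace_add0r. Qed.

(** The first two equations say that [x] is additively central and in the kernel of [lam]. Then
    [x ∘ y = y + x], while [y ∘ x = y + lam y x], so commuting for [∘] amounts to [star y x = 0]. *)
Lemma ann_setE (A : skewBraceType) (x : A) :
  ann_set x <->
  forall y, [/\ add_comm x y = 0, star x y = 0 & star y x = 0].
Proof.
have commE y : add_comm x y = 0 <-> x + y = y + x.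
  split=> [/brace_subr_eq0 e|e]; first by rewrite -{2}e brace_addNKr.
  by apply/brace_subr_eq0; rewrite e brace_addKr.
split=> [[[kx zx] cx] y|xP].
  split; [exact/commE/zx | apply/brace_subr_eq0/kx |].
  apply/brace_subr_eq0; rewrite -[_ + _]/(lam y x).
  by apply: (@brace_addIl _ y); rewrite -circE -cx circE kx zx.
have kx y : lam x y = y by apply/brace_subr_eq0; case: (xP y).
have zx y : x + y = y + x by apply/commE; case: (xP y).
split=> // y /=; rewrite !circE kx zx; congr (_ + _).
by apply/esym/brace_subr_eq0; case: (xP y).
Qed.

(** Each [y] in [B] has a partner [x] in [A]; the values for [a] and [x] vanish, so those for [b]
    and [y] are [Th]-related to 0 and vanish too. *)
Lemma isoclinism_rel_ann (A B : skewBraceType) (R Th : A -> B -> Prop) a b :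
  isoclinism_rel R Th -> R a b -> ann_set a -> ann_set b.
Proof.
case=> -[_ _ Rr] [_ _ Tr] RT Rab /ann_setE aP; apply/ann_setE => y.
have [x Rxy] := Rr y; have [c1 s1 s2] := aP x.
have [] := RT _ _ _ _ Rab Rxy; have [_] := RT _ _ _ _ Rxy Rab.
by rewrite c1 s1 s2; split; apply: Tr.
Qed.

(** * Isomorphisms and their graphs *)

Section Morphism.
Variables (A B : skewBraceType) (f : A -> B).
Hypotheses (fD : {morph f : x y / x + y}) (fM : {morph f : x y / x ∘ y}).

Lemma brace_morph0 : f 0 = 0.
Proof.
by apply: (@brace_addIl _ (f 0)); rewrite -fD !brace_add0r.
Qed.

Lemma brace_morphN : {morph f : x / - x}.
Proof.
move=> x; apply: (@brace_addIl _ (f x)).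
by rewrite -fD !brace_addNr brace_morph0.
Qed.

Lemma brace_morphV : {morph f : x / x^-1%g}.
Proof.
move=> x; apply: (@mulgI _ (f x)).
by rewrite -fM !mulgV !circ_one brace_morph0.
Qed.

Lemma brace_rel_graph : brace_rel (fun x y => f x = y).
Proof.
split; first exact: brace_morph0.
- by move=> a b a' b' <- <-; rewrite fD.
- by move=> a b <-; rewrite brace_morphN.
- by move=> a b a' b' <- <-; rewrite fM.
- by move=> a b <-; rewrite brace_morphV.
Qed.

End Morphism.

(** The difference of two partners of one element is related to 0, hence is 0. So partners are
    unique on both sides, and choice functions for [G] and its converse are mutually inverse. *)
Lemma iso_of_rel (A B : skewBraceType) (G : A -> B -> Prop) :
    brace_rel G -> total_rel G -> total_rel (converse G) ->
    trivial_kernel G -> trivial_kernel (converse G) ->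
  exists2 f : A -> B, skew_brace_iso f & forall a b, G a b <-> f a = b.
Proof.
move=> [G0 GD GN GM _] Gl Gr Kl Kr.
have uniqr a b b' : G a b -> G a b' -> b = b'.
  move=> Gb Gb'; apply/brace_addNl_eq0/Kr.
  by rewrite /converse -(brace_addNl a); apply: GD => //; apply: GN.
have uniql a a' b : G a b -> G a' b -> a = a'.
  move=> Gb Gb'; apply/brace_addNl_eq0/Kl.
  by rewrite -(brace_addNl b); apply: GD => //; apply: GN.
have [f fP] := choice Gl; have [g gP] := choice Gr.
exists f => [|a b]; last by split=> [Gab|<-//]; apply: uniqr Gab.
split=> [x y|x y|].
- by apply: uniqr (fP _) _; apply: GD.
- by apply: uniqr (fP _) _; apply: GM.
- exists g => x; first exact: uniql (gP _) (fP _).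
  exact: uniqr (fP _) (gP _).
Qed.

(** * Commutator values modulo the annihilator *)

Lemma ann_class_surj (A : skewBraceType) (q : quot_brace (Ann A)) :
  exists a, ann_class a = q.
Proof. by elim/quot_braceW: q => a; exists a. Qed.

Lemma ann_class_eq (A : skewBraceType) (a b : A) :
  ann_class a = ann_class b <-> ann_set (- a + b).
Proof.
by split=> [/quot_eqP/asboolP|?] //; apply/quot_eqP/asboolP.
Qed.

Lemma ann_class_eq0 (A : skewBraceType) (a : A) :
  ann_class a = 0 <-> ann_set a.
Proof.
split=> [/esym/ann_class_eq|Aa]; first by rewrite brace_opp0 brace_add0l.
by apply/esym/ann_class_eq; rewrite brace_opp0 brace_add0l.
Qed.

Lemma ann_comm_congr (A : skewBraceType) (a b x y : A) :
    ann_set x -> ann_set y ->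
  add_comm (a + x) (b + y) = add_comm a b /\ star (a + x) (b + y) = star a b.
Proof.
move=> Ax Ay; have [[kx zx] cx] := Ax; have [[ky zy] cy] := Ay.
split.
  rewrite /add_comm !brace_oppD !brace_addA.
  (* [x] moves right past [b] and [y] to meet [- x], then [y] past [- a] to meet [- y]. *)
  rewrite -(brace_addA a x b) zx !brace_addA.
  rewrite -(brace_addA (a + b) x y) (zx y) !brace_addA.
  rewrite -(brace_addA _ x) brace_addNr brace_add0r.
  rewrite -(brace_addA (a + b)) (zy (- a)) brace_addA.
  by rewrite brace_addKr.
have ly : lam a y = y.
  by apply/brace_subr_eq0; have /ann_setE/(_ a)[] := Ay.
(* As a [∘]-product, [a + x] acts through [lam] as [a] does. *)
have xE : a + x = a ∘ x by rewrite -cx circE kx zx.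
rewrite /star -!/(lam _ _) xE lamM kx lamD ly brace_oppD !brace_addA.
by rewrite brace_addKr.
Qed.

Lemma ann_class_comm (A : skewBraceType) (a a' b b' : A) :
    ann_class a = ann_class a' -> ann_class b = ann_class b' ->
  add_comm a b = add_comm a' b' /\ star a b = star a' b'.
Proof.
move=> /ann_class_eq Aa /ann_class_eq Ab.
rewrite -[a'](brace_addNKl a) -[b'](brace_addNKl b).
by have [-> ->] := ann_comm_congr a b Aa Ab.
Qed.

(** * Passing between isoclinisms and pairs of relations *)

Lemma isoclinism_relP (A B : skewBraceType) :
  isoclinic A B -> exists R Th, @isoclinism_rel A B R Th.
Proof.
case=> xi [theta [[xD xM [xi' xK xK']] [tD tM [theta' tK _]] RT]].
exists (fun a b => xi (ann_class a) = ann_class b).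
(* The graph of [theta] is viewed inside [A] and [B] themselves, so that it can later be restricted
   to other sub skew braces. *)
exists (fun x y => exists2 u, val u = x & val (theta u) = y).
have [X0 XD XN XM XV] := brace_rel_graph xD xM.
have [T0 TD TN TM TV] := brace_rel_graph tD tM.
split; [split|split|].
- split=> //.
  + by move=> a b a' b' /XD /[apply]; rewrite -!pi_add.
  + by move=> a b /XN; rewrite -!pi_opp.
  + by move=> a b a' b' /XM /[apply]; rewrite -!pi_mul.
  + move=> a b /XV; rewrite -[_^-1%g]/(quot_inv (ann_class a)).
    by rewrite -[_^-1%g]/(quot_inv (ann_class b)) !quot_invE.
- by move=> a; have [b <-] := ann_class_surj (xi (ann_class a)); exists b.
- move=> b; have [a ea] := ann_class_surj (xi' (ann_class b)).
  by exists a; rewrite /converse ea xK'.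
- split.
  + by exists 0; rewrite ?T0.
  + by move=> _ _ _ _ [u <- <-] [v <- <-]; exists (u + v); rewrite ?tD.
  + by move=> _ _ [u <- <-]; exists (- u); rewrite ?(TN _ _ erefl).
  + by move=> _ _ _ _ [u <- <-] [v <- <-]; exists (u ∘ v); rewrite ?tM.
  + by move=> _ _ [u <- <-]; exists u^-1%g; rewrite ?(TV _ _ erefl).
- move=> _ [u <- tu0]; have /(can_inj tK)-> // : theta u = theta 0.
  by rewrite T0; apply: val_inj.
- move=> _ [u u0 <-]; have -> : u = 0 by apply: val_inj.
  by rewrite T0.
- move=> a1 b1 a2 b2 r1 r2; have [e1 e2] := RT _ _ _ _ r1 r2; split.
  + by exists (commutator_add_comm a1 a2); rewrite ?e1.
  + by exists (commutator_star a1 a2); rewrite ?e2.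
Qed.

(** The elements having a [Th]-partner in the commutator of [B] form an additive subgroup that
    contains the generators of the commutator of [A]. *)
Lemma commutator_rel_total (A B : skewBraceType) (R Th : A -> B -> Prop) :
    isoclinism_rel R Th ->
  forall x, commutator_set x -> exists2 y, commutator_set y & Th x y.
Proof.
case=> -[_ Rl _] [[T0 TD TN _ _] _ _] RT x.
have [[C0 CD CN] _] := @commutator_setP B.
apply: (smallest_sub (X := [set x | exists2 y, commutator_set y & Th x y])).
  split=> [|a a' [b Cb Tb] [b' Cb' Tb']|a [b Cb Tb]]; first by exists 0.
  - by exists (b + b'); [apply: CD|apply: TD].
  - by exists (- b); [apply: CN|apply: TN].
move=> _ [] [a _ [a' _ <-]]; have [b Rb] := Rl a; have [b' Rb'] := Rl a';
  have [? ?] := RT _ _ _ _ Rb Rb'.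
- by exists (add_comm b b') => //; apply: add_comm_in.
- by exists (star b b') => //; apply: star_in.
Qed.

Lemma isoclinic_of_rel (A B : skewBraceType) (R Th : A -> B -> Prop) :
  isoclinism_rel R Th -> isoclinic A B.
Proof.
move=> RTh; have RThc := isoclinism_rel_converse RTh.
have [[Rb Rl Rr] [Tb Tl Tr] RT] := RTh.
pose X (p : quot_brace (Ann A)) (q : quot_brace (Ann B)) :=
  exists a b, [/\ ann_class a = p, ann_class b = q & R a b].
pose Y (u : sub_brace (commutator A)) (v : sub_brace (commutator B)) :=
  Th (val u) (val v).
have [||||| xi isoxi xiP] := @iso_of_rel _ _ X.
- case: Rb => R0 RD RN RM RV; split.
  + by exists 0, 0.
  + move=> _ _ _ _ [a [b [<- <- ?]]] [a' [b' [<- <- ?]]].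
    exists (a + a'), (b + b'); rewrite /ann_class !pi_add.
    by split=> //; apply: RD.
  + move=> _ _ [a [b [<- <- ?]]]; exists (- a), (- b).
    by rewrite /ann_class !pi_opp; split=> //; apply: RN.
  + move=> _ _ _ _ [a [b [<- <- ?]]] [a' [b' [<- <- ?]]].
    exists (a ∘ a'), (b ∘ b'); rewrite /ann_class !pi_mul.
    by split=> //; apply: RM.
  + move=> _ _ [a [b [<- <- ?]]]; exists a^-1%g, b^-1%g.
    by split; [exact/esym/quot_invE|exact/esym/quot_invE|apply: RV].
- elim/quot_braceW=> a; have [b Rab] := Rl a.
  by exists (ann_class b), a, b.
- elim/quot_braceW=> b; have [a Rab] := Rr b.
  by exists (ann_class a), a, b.
- move=> _ [a [b [<- /ann_class_eq0 Ab Rab]]].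
  by apply/ann_class_eq0; apply: (isoclinism_rel_ann RThc Rab).
- move=> _ [a [b [/ann_class_eq0 Aa <- Rab]]].
  by apply/ann_class_eq0; apply: (isoclinism_rel_ann RTh Rab).
have [||||| theta isotheta thetaP] := @iso_of_rel _ _ Y.
- case: Tb => T0 TD TN TM TV; split=> //.
  + by move=> a b a' b'; apply: TD.
  + by move=> a b; apply: TN.
  + by move=> a b a' b'; apply: TM.
  + by move=> a b; apply: TV.
- move=> u; have [y Cy Ty] := commutator_rel_total RTh (set_mem (valP u)).
  by exists (exist _ y (mem_set Cy)).
- move=> v; have [x Cx Tx] := commutator_rel_total RThc (set_mem (valP v)).
  by exists (exist _ x (mem_set Cx)).
- by move=> u /Tl u0; apply: val_inj.
- by move=> v /Tr v0; apply: val_inj.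
(* Representatives of corresponding classes need not be [R]-related; [b] is replaced by an
   [R]-partner of [a] in its class, which leaves the commutator values unchanged. *)
have annR a b : xi (ann_class a) = ann_class b ->
    exists2 b', R a b' & ann_class b' = ann_class b.
  move=> e; have [b' Rab'] := Rl a; exists b' => //.
  by rewrite -e; apply/esym/xiP; exists a, b'.
exists xi, theta; split=> // a1 a2 b1 b2 /annR[c1 r1 e1] /annR[c2 r2 e2].
have [tc ts] := RT _ _ _ _ r1 r2.
have [ec es] := ann_class_comm e1 e2.
by split; apply/thetaP; rewrite /Y /= -?ec -?es.
Qed.

(** * Images of sub skew braces *)

Section Image.
Variables (A B : skewBraceType) (R : A -> B -> Prop) (Rb : brace_rel R).

Lemma image_rel_sub (S : subSkewBrace A) :
  is_sub_skew_brace [set b | exists2 a, sub_set S a & R a b].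
Proof.
case: Rb (sub_setP S) => R0 RD RN RM RV [[S0 SD SN] [_ SM SV]].
split; split.
- by exists 0.
- move=> x y [a Sa Ra] [b Sb Rb']; exists (a + b); [exact: SD|exact: RD].
- by move=> x [a Sa Ra]; exists (- a); [exact: SN|exact: RN].
- by exists 0; rewrite ?circ_one.
- move=> x y [a Sa Ra] [b Sb Rb']; exists (a ∘ b); [exact: SM|exact: RM].
- by move=> x [a Sa Ra]; exists a^-1%g; [exact: SV|exact: RV].
Qed.

Definition image_rel (S : subSkewBrace A) : subSkewBrace B :=
  SubSkewBrace (image_rel_sub S).

End Image.

Lemma ann_sub_image_rel (A B : skewBraceType) (R Th : A -> B -> Prop)
    (Rb : brace_rel R) (S : subSkewBrace A) :
  isoclinism_rel R Th -> Ann A `<=` S -> Ann B `<=` image_rel Rb S.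
Proof.
move=> RTh AS b Ab; have [[_ _ Rr] _ _] := RTh; have [a Rab] := Rr b.
exists a => //; apply: AS.
exact: isoclinism_rel_ann (isoclinism_rel_converse RTh) Rab Ab.
Qed.

(** Going forth and back changes an element of [S] only by some [c] with [R c 0]; such a [c] lies in
    [Ann A], hence in [S]. *)
Lemma image_relK (A B : skewBraceType) (R Th : A -> B -> Prop)
    (Rb : brace_rel R) (Rbc : brace_rel (converse R)) (S : subSkewBrace A) :
  isoclinism_rel R Th -> Ann A `<=` S -> image_rel Rbc (image_rel Rb S) = S.
Proof.
move=> RTh AS; have [[_ Rl _] _ _] := RTh; have [_ RD RN _ _] := Rb.
have [[_ SD _] _] := sub_setP S.
apply: subSkewBrace_ext; apply/seteqP; split=> a; last first.
  by move=> Sa; have [b Rab] := Rl a; exists b => //; exists a.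
case=> b [a' Sa' Ra'b] Rab; rewrite -[a](brace_addNKl a'); apply: SD => //.
have R0 : R (- a' + a) 0 by rewrite -(brace_addNl b); apply: RD => //; apply: RN.
apply: AS; apply: isoclinism_rel_ann (isoclinism_rel_converse RTh) R0 _.
by case: (@ann_setP B) => -[[]].
Qed.

(** Restricting [R] and [Th] to [S] and its image gives an [isoclinism_rel] again; totality onto the
    image holds by its definition. *)
Lemma image_rel_isoclinic (A B : skewBraceType) (R Th : A -> B -> Prop)
    (Rb : brace_rel R) (S : subSkewBrace A) :
  isoclinism_rel R Th -> isoclinic (sub_brace S) (sub_brace (image_rel Rb S)).
Proof.
case=> -[_ Rl _] [Tb Tl Tr] RT; set T := image_rel Rb S.
have pull (Q : A -> B -> Prop) : brace_rel Q ->
    brace_rel (fun (x : sub_brace S) (y : sub_brace T) => Q (val x) (val y)).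
  case=> Q0 QD QN QM QV; split=> //.
  - by move=> a b a' b'; apply: QD.
  - by move=> a b; apply: QN.
  - by move=> a b a' b'; apply: QM.
  - by move=> a b; apply: QV.
apply: (@isoclinic_of_rel (sub_brace S) (sub_brace T)
  (fun x y => R (val x) (val y)) (fun x y => Th (val x) (val y))).
split; [split; first exact: pull|split; first exact: pull|].
- move=> x; have [b Rxb] := Rl (val x).
  have Tb' : sub_set T b by exists (val x) => //; apply/set_mem/valP.
  by exists (exist _ b (mem_set Tb')).
- move=> y; have [a Sa Ray] := set_mem (valP y).
  by exists (exist _ a (mem_set Sa)).
- by move=> x /Tl x0; apply: val_inj.
- by move=> y /Tr y0; apply: val_inj.
(* Commutator values in a sub skew brace are those of the ambient one by computation. *)
- by move=> x1 y1 x2 y2; apply: RT.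
Qed.

(** * The correspondence of sub skew braces *)

Theorem proposition2p9 (A B : skewBraceType) (hAB : isoclinic A B) :
  exists f : subSkewBrace A -> subSkewBrace B,
    set_bij [set S : subSkewBrace A | Ann A `<=` S]
            [set T : subSkewBrace B | Ann B `<=` T] f /\
    forall S : subSkewBrace A, Ann A `<=` S ->
      isoclinic (sub_brace S) (sub_brace (f S)).
Proof.
have [R [Th RTh]] := isoclinism_relP hAB.
have RThc := isoclinism_rel_converse RTh.
have [[Rb _ _] _ _] := RTh; have [[Rbc _ _] _ _] := RThc.
exists (image_rel Rb); split; last by move=> S _; apply: image_rel_isoclinic RTh.
split.
- by move=> S /= AS; apply: ann_sub_image_rel RTh AS.
(* The image under [converse R] is a two-sided inverse on the sub skew braces containing the
   annihilators. *)
- move=> S1 S2 /set_mem AS1 /set_mem AS2 eS.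
  by rewrite -(image_relK Rb Rbc RTh AS1) eS (image_relK Rb Rbc RTh AS2).
- move=> T /= BT; exists (image_rel Rbc T).
    exact: ann_sub_image_rel RThc BT.
  exact: image_relK RThc BT.
Qed.
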